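(* $T(3,4,2)=13$.
   Context: For integers $d\geq 1$ and $2\leq k\leq r$, $T(d,r,k)$ denotes the smallest positive integer $n$ with the following property: for any list $a_1,\dots,a_n$ of (not necessarily distinct) points in $\mathbb{R}^d$, there is a partition of the index set $\{1,\dots,n\}$ into $r$ disjoint parts $N_1,\dots,N_r$ such that every $k$ of the $r$ convex hulls $\mathrm{conv}\{a_i : i\in N_j\}$ ($j=1,\dots,r$) have a point in common. *)

(* Defs.v *)
From HB Require Import structures.
From mathcomp Require Import all_boot all_order all_algebra.
From mathcomp Require Import mathcomp_extra boolp classical_sets reals convex.

Set Implicit Arguments.
Unset Strict Implicit.
Unset Printing Implicit Defensive.

Local Open Scope classical_set_scope.

Definition conv_hull (R : realType) (E : lmodType R) (A : set E) : set E :=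
  smallest (@convex_set R E) A.

(* Parts may be empty a priori; since an empty part has an empty hull, the
   intersection condition rules this out whenever 1 <= k <= r. *)
Definition tverberg_partition (R : realType) (d r k n : nat)
    (a : 'I_n -> 'rV[R]_d) (N : 'I_r -> set 'I_n) : Prop :=
  [/\ trivIset [set: 'I_r] N,
      \bigcup_j N j = [set: 'I_n] &
      forall J : {set 'I_r}, #|J| = k ->
        \bigcap_(j in [set j | j \in J]) conv_hull (a @` N j) !=set0].

(* The positive n such that every list of n points, repetitions allowed,
   has such a partition. *)
Definition tverberg_sizes (R : realType) (d r k : nat) : set nat :=
  [set n | (0 < n)%N /\ forall a : 'I_n -> 'rV[R]_d,
             exists N : 'I_r -> set 'I_n, tverberg_partition k a N].

(* The least element of tverberg_sizes; the default 0, returned if there is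
   none, is not itself in tverberg_sizes. *)
Definition T (R : realType) (d r k : nat) : nat :=
  xget 0%N (tverberg_sizes R d r k `&` lbound (tverberg_sizes R d r k)).

(* Main.v *)
Require Import Defs.
From mathcomp Require Import all_boot all_order all_algebra.
From mathcomp Require Import reals.
From mathcomp Require Import mathcomp_extra boolp classical_sets convex.
From mathcomp Require Import interval_inference topology normedtype derive.
From mathcomp Require Import ring lra zify.

(* The upper bound is Tverberg's theorem for r = 4 in dimension 3, obtained from
   the colourful Caratheodory theorem by Sarkaria's tensor trick. For colourful
   Caratheodory, take a rainbow choice whose hull is nearest to the origin, with
   nearest point z. If z is not 0, some colour is superfluous for z, and replacing
   its point by one on the other side of the hyperplane orthogonal to z brings
   the hull closer.

   For the lower bound, consider twelve points such that disjoint sets of sizes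
   (1, 1), (1, 2), (1, 3) or (2, 2) are always separated by a plane. In a partition
   into four blocks with pairwise intersecting hulls, any two blocks then have
   at least five points together, so the block sizes are 2, 3, 3, 4 or
   3, 3, 3, 3. For the points chosen here, a finite check against a list of
   planes shows that every such partition has two separated blocks. *)

Set Implicit Arguments.
Unset Strict Implicit.
Unset Printing Implicit Defensive.

Import Order.TTheory GRing.Theory Num.Theory.
Import numFieldNormedType.Exports.
Local Open Scope ring_scope.
Local Open Scope classical_set_scope.
Local Open Scope convex_scope.

(** * Convex hulls *)

Lemma convex_set0 (R : realType) (E : lmodType R) :
  convex_set (set0 : set (convex_lmodType E)).
Proof. by move=> x y l; rewrite inE. Qed.

Lemma sub_conv_hull (R : realType) (E : lmodType R) (A B : set E) :
  A `<=` B -> conv_hull A `<=` conv_hull B.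
Proof. by move=> AB x Ax C [cC BC]; apply: Ax; split=> // y /AB /BC. Qed.

Lemma conv_hull_min (R : realType) (E : lmodType R) (A C : set E) :
  @convex_set R E C -> A `<=` C -> conv_hull A `<=` C.
Proof. by move=> cC AC; exact: smallest_sub. Qed.

Lemma conv_hull0 (R : realType) (E : lmodType R) :
  conv_hull (set0 : set E) = set0.
Proof.
by apply/seteqP; split => // x; apply: conv_hull_min => //; exact: convex_set0.
Qed.

(** Split off one point of [s] at a time: the new barycentre is a convex combination of [x i] and
    the barycentre of the tail. A tail of weight 0 contributes nothing. *)
Lemma conv_hull_sum (R : realType) (E : lmodType R) (A : set E) (I : finType)
    (P : pred I) (w : I -> R) (x : I -> E) :
    (forall i, P i -> 0 <= w i) -> (forall i, P i -> A (x i)) ->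
    0 < \sum_(i | P i) w i ->
  conv_hull A ((\sum_(i | P i) w i)^-1 *: \sum_(i | P i) w i *: x i).
Proof.
move=> w0 Ax W_gt0 C [cC AC].
suff gen (s : seq I) : 0 < \sum_(i <- s | P i) w i ->
    C ((\sum_(i <- s | P i) w i)^-1 *: \sum_(i <- s | P i) w i *: x i) by exact: gen.
elim: s => [|i s IHs]; first by rewrite big_nil ltxx.
rewrite !big_cons; case: ifPn => // Pi; set W := \sum_(_ <- s | _) _ in IHs *.
set S := \sum_(_ <- s | _) _ in IHs *.
have W_ge0 : 0 <= W by apply: sumr_ge0.
have [W0|W0] := eqVneq W 0.
  have S0 : S = 0.
    move/eqP: W0; rewrite psumr_eq0// => /allP W0.
    rewrite /S big_seq_cond big1// => k /andP[ks Pk].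
    by have := W0 k ks; rewrite Pk /= => /eqP->; rewrite scale0r.
  rewrite W0 S0 !addr0 => wi; rewrite scalerA mulVf ?gt_eqF// scale1r.
  by apply: AC; exact: Ax.
have {W0}W_gt0' : 0 < W by rewrite lt_neqAle eq_sym W0.
move=> wW; have t0 : 0 <= w i / (w i + W) by rewrite divr_ge0 ?w0// ltW.
have t1 : w i / (w i + W) <= 1 by rewrite ler_pdivrMr// mul1r lerDl.
have := cC (x i) (W^-1 *: S) (Itv01 t0 t1).
rewrite !inE => /(_ (AC _ (Ax _ Pi)) (IHs W_gt0')).
congr C; rewrite /conv /= /unstable.onem /= scalerDr !scalerA; congr (_ *: _ + _ *: _).
  by rewrite mulrC.
by field; rewrite !gt_eqF.
Qed.

(** * Tverberg's theorem *)

Definition dot (R : realType) (n : nat) (u v : 'rV[R]_n) : R := (u *m v^T) 0 0.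

Lemma dotE (R : realType) n (u v : 'rV[R]_n) : dot u v = \sum_k u 0 k * v 0 k.
Proof. by rewrite /dot mxE; apply: eq_bigr => k _; rewrite mxE. Qed.

Lemma dotDl (R : realType) n (u v w : 'rV[R]_n) : dot (u + v) w = dot u w + dot v w.
Proof. by rewrite /dot mulmxDl mxE. Qed.

Lemma dotC (R : realType) n (u v : 'rV[R]_n) : dot u v = dot v u.
Proof. by rewrite !dotE; apply: eq_bigr => k _; rewrite mulrC. Qed.

Lemma dotZl (R : realType) n a (u v : 'rV[R]_n) : dot (a *: u) v = a * dot u v.
Proof. by rewrite /dot -scalemxAl mxE. Qed.

Lemma dotNl (R : realType) n (u v : 'rV[R]_n) : dot (- u) v = - dot u v.
Proof. by rewrite -scaleN1r dotZl mulN1r. Qed.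

Lemma dotDr (R : realType) n (u v w : 'rV[R]_n) : dot w (u + v) = dot w u + dot w v.
Proof. by rewrite dotC dotDl !(dotC w). Qed.

Lemma dotZr (R : realType) n a (u v : 'rV[R]_n) : dot u (a *: v) = a * dot u v.
Proof. by rewrite dotC dotZl dotC. Qed.

Lemma dotNr (R : realType) n (u v : 'rV[R]_n) : dot u (- v) = - dot u v.
Proof. by rewrite dotC dotNl dotC. Qed.

Lemma dot0r (R : realType) n (u : 'rV[R]_n) : dot u 0 = 0.
Proof. by rewrite /dot trmx0 mulmx0 mxE. Qed.

Lemma dot_sumr (R : realType) n (I : finType) (u : 'rV[R]_n) (v : I -> 'rV[R]_n) :
  dot u (\sum_i v i) = \sum_i dot u (v i).
Proof. exact: (big_morph _ (fun v w => dotDr v w u) (dot0r u)). Qed.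

Lemma dot_ge0 (R : realType) n (u : 'rV[R]_n) : 0 <= dot u u.
Proof. by rewrite dotE; apply: sumr_ge0 => k _; rewrite -expr2 sqr_ge0. Qed.

Lemma dot_eq0 (R : realType) n (u : 'rV[R]_n) : (dot u u == 0) = (u == 0).
Proof.
apply/eqP/eqP => [|->]; last exact: dot0r.
rewrite dotE => /eqP; rewrite psumr_eq0 => [/allP u0|k _]; last by rewrite -expr2 sqr_ge0.
apply/rowP => k; rewrite mxE; apply/eqP.
by have := u0 k (mem_index_enum _); rewrite /= mulf_eq0 orbb.
Qed.

(** Otherwise a small move from [z] towards [y] would decrease the squared norm. *)
Lemma nearest_dot (R : realType) n (z y : 'rV[R]_n) :
    (forall t : R, 0 <= t <= 1 ->
      dot z z <= dot ((1 - t) *: z + t *: y) ((1 - t) *: z + t *: y)) ->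
  dot z z <= dot z y.
Proof.
move=> zmin; rewrite leNgt; apply/negP => zy.
have s_ge0 := dot_ge0 (y - z).
have sE : dot (y - z) (y - z) = dot y y - 2 * dot z y + dot z z.
  by rewrite !dotDl !dotNl !dotDr !dotNr (dotC y z); ring.
set s := dot (y - z) (y - z) in s_ge0 sE.
have den : 0 < s + (dot z z - dot z y) by lra.
(* The squared norm changes by [t * (t * s - 2 * e)], where [e = dot z z - dot z y]. The minimiser
   [e / s] could exceed 1; [e / (s + e)] cannot, and the change is still negative. *)
pose t := (dot z z - dot z y) / (s + (dot z z - dot z y)).
have tE : t * (s + (dot z z - dot z y)) = dot z z - dot z y.
  by rewrite divfK// gt_eqF.
have t_gt0 : 0 < t by rewrite divr_gt0// subr_gt0.
have t_le1 : t <= 1 by rewrite ler_pdivrMr// mul1r lerDr.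
have := zmin t; rewrite (ltW t_gt0) t_le1 => /(_ isT).
rewrite !dotDl !dotDr !dotZl !dotZr (dotC y z) => h.
have : 0 <= t * (t * s - 2 * (dot z z - dot z y)) by rewrite sE; lra.
rewrite pmulr_rge0//.
suff : t * s < dot z z - dot z y + (dot z z - dot z y) by lra.
by nra.
Qed.

(** * The standard simplex and its faces *)

Definition simplex (R : realType) (n : nat) : set 'rV[R]_n :=
  [set w | (forall i, 0 <= w 0 i) /\ \sum_i w 0 i = 1].

Lemma simplex_conv (R : realType) n (u v : 'rV[R]_n) (t : R) :
  0 <= t <= 1 -> simplex u -> simplex v -> simplex ((1 - t) *: u + t *: v).
Proof.
move=> /andP[t0 t1] [u0 u1] [v0 v1]; split=> [i|].
  by rewrite !mxE addr_ge0// mulr_ge0// subr_ge0.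
under eq_bigr do rewrite !mxE.
by rewrite big_split /= -!mulr_sumr u1 v1 !mulr1 subrK.
Qed.

Lemma simplex_delta (R : realType) n (i : 'I_n) : simplex (delta_mx 0 i : 'rV[R]_n).
Proof.
split=> [j|]; first by rewrite mxE; case: (_ && _).
rewrite (bigD1 i)//= big1 => [|j /negbTE ij]; first by rewrite mxE !eqxx addr0.
by rewrite mxE ij andbF.
Qed.

Lemma compact_simplex (R : realType) n : compact (@simplex R n).
Proof.
have cube : compact [set w : 'rV[R]_n | forall i, `[0, 1] (w ord0 i)].
  by apply: (@rV_compact R n (fun=> `[0, 1])) => i; exact: segment_compact.
apply: (subclosed_compact _ cube) => [|w [w0 w1] i /=]; last first.
  rewrite in_itv /= w0 -w1 (bigD1 i)//= lerDl; apply: sumr_ge0 => j _; exact: w0.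
have -> : @simplex R n = (\bigcap_i [set w : 'rV_n | 0 <= w 0 i]) `&`
    [set w : 'rV_n | \sum_i w 0 i = 1].
  by apply/seteqP; split => w [w0 w1]; split => // i; [move=> _|]; apply: w0.
apply: closedI.
  apply: closed_bigI => i _; apply: (preimage_closed _ (@closed_ge _ _)) => w _.
  exact: coord_continuous.
apply: (preimage_closed _ (@closed_eq _ _)) => w _.
by apply: continuous_big => [|i _]; [exact: add_continuous|exact: coord_continuous].
Qed.

Lemma simplex_min (R : realType) n D (X : 'M[R]_(n.+1, D)) :
  exists2 w, simplex w &
    forall w', simplex w' -> dot (w *m X) (w *m X) <= dot (w' *m X) (w' *m X).
Proof.
have [| |w] := @EVT_min_rV R n.+1 (fun w => dot (w *m X) (w *m X)) _ _
  (@compact_simplex R n.+1).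
- by exists (delta_mx 0 0); exact: simplex_delta.
- apply: continuous_subspaceT => /=.
  have coordX k : continuous (fun w : 'rV[R]_n.+1 => (w *m X) 0 k).
    under eq_fun do rewrite mxE.
    apply: continuous_big => [|i _]; first exact: add_continuous.
    move=> w; apply: continuousM; [exact: coord_continuous|exact: cst_continuous].
  under eq_fun do rewrite dotE.
  apply: continuous_big => [|k _]; first exact: add_continuous.
  by move=> w; apply: continuousM; exact: coordX.
- by rewrite inE => ws wmin; exists w => // w' w's; apply: wmin; rewrite inE.
Qed.

(** Ratio test: moving from [w] along [- m], a coordinate first vanishes at the least ratio
    [w i / m i] over the positive entries of [m]. *)
Lemma simplex_face (R : realType) n (w m : 'rV[R]_n) :
    simplex w -> m != 0 -> \sum_i m 0 i = 0 ->
  exists t i, simplex (w - t *: m) /\ (w - t *: m) 0 i = 0.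
Proof.
move=> [w0 w1] m0 sm.
have [i0 mi0] : exists i, 0 < m 0 i.
  apply: contrapT => /forallNP m_le0; case/eqP: m0; apply/rowP => i; rewrite mxE.
  apply/eqP; rewrite -oppr_eq0; move: i.
  have /eqP : \sum_i - m 0 i = 0 by rewrite sumrN sm oppr0.
  rewrite psumr_eq0 => [/allP h i|i _]; first exact: h (mem_index_enum i).
  by rewrite oppr_ge0 leNgt; apply/negP.
case: (@arg_minP _ _ _ i0 (fun i => 0 < m 0 i) (fun i => w 0 i / m 0 i)) => //= i mi imin.
exists (w 0 i / m 0 i), i; split; last by rewrite !mxE divfK ?subrr// gt_eqF.
split=> [j|]; last first.
  by under eq_bigr do rewrite !mxE; rewrite big_split /= sumrN -mulr_sumr sm mulr0 subr0.
rewrite !mxE subr_ge0; have [mj|mj] := ltP 0 (m 0 j).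
  by rewrite -ler_pdivlMr// imin.
by rewrite (le_trans _ (w0 j))// mulr_ge0_le0// divr_ge0// ltW.
Qed.

(* All rows in the support of [w] lie on the hyperplane [dot z _ = dot z z], so
   [D.+1] of them are affinely dependent. *)
Lemma nearest_face (R : realType) D (X : 'M[R]_(D.+1, D)) w :
    simplex w ->
    (forall w', simplex w' -> dot (w *m X) (w *m X) <= dot (w' *m X) (w' *m X)) ->
    w *m X != 0 ->
  exists w' i, [/\ simplex w', w' *m X = w *m X & w' 0 i = 0].
Proof.
move=> ws wmin z_neq0; set z := w *m X in wmin z_neq0 *.
have [[i wi]|/forallNP w_neq0] := pselect (exists i, w 0 i = 0); first by exists w, i.
have w_gt0 i : 0 < w 0 i by rewrite lt_neqAle eq_sym ws.1 andbT; apply/eqP.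
have zX i : dot z z <= dot z (row i X).
  apply: nearest_dot => t t01.
  have -> : (1 - t) *: z + t *: row i X = ((1 - t) *: w + t *: delta_mx 0 i) *m X.
    by rewrite mulmxDl -!scalemxAl -rowE.
  by apply: wmin; apply: simplex_conv => //; exact: simplex_delta.
have dotX (u : 'rV_D.+1) : dot z (u *m X) = \sum_i u 0 i * dot z (row i X).
  by rewrite mulmx_sum_row dot_sumr; apply: eq_bigr => i _; rewrite dotZr.
(* A mean, with positive weights, of nonnegative differences vanishes, so each of them does. *)
have {}zX i : dot z (row i X) = dot z z.
  apply/eqP; rewrite -subr_eq0; apply/eqP.
  have : \sum_j w 0 j * (dot z (row j X) - dot z z) == 0.
    under eq_bigr do rewrite mulrBr.
    by rewrite big_split /= sumrN -mulr_suml ws.2 mul1r -dotX subrr.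
  rewrite psumr_eq0 => [/allP/(_ i (mem_index_enum i))|j _].
    by rewrite /= mulf_eq0 (gt_eqF (w_gt0 i)) => /eqP.
  by rewrite mulr_ge0 ?ws.1// subr_ge0.
have : kermx X != 0.
  by rewrite kermx_eq0 -row_leq_rank -ltnNge ltnS rank_leq_col.
case/rowV0Pn => m /sub_kermxP mX m_neq0.
have sm : \sum_i m 0 i = 0.
  have := dotX m; rewrite mX dot0r; under eq_bigr do rewrite zX.
  rewrite -mulr_suml => /esym/eqP; rewrite mulf_eq0 dot_eq0 (negbTE z_neq0) orbF.
  by move/eqP.
have [t [i [ts ti]]] := simplex_face ws m_neq0 sm.
exists (w - t *: m), i; split => //.
by rewrite mulmxBl -scalemxAl mX scaler0 subr0.
Qed.

(** * The colourful Caratheodory theorem *)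

Lemma colorful_caratheodory (R : realType) D (I : finType)
    (x : 'I_D.+1 -> I -> 'rV[R]_D) :
    (forall i, exists p : I -> R,
      [/\ forall j, 0 <= p j, \sum_j p j = 1 & \sum_j p j *: x i j = 0]) ->
  exists (c : 'I_D.+1 -> I) (w : 'rV[R]_D.+1),
    simplex w /\ \sum_i w 0 i *: x i (c i) = 0.
Proof.
move=> x0.
(* The hull of colour [i] contains 0, so this colour cannot lie wholly on the open positive side of
   [z]. *)
have x_le0 z i : exists j, dot z (x i j) <= 0.
  have [p [p0 p1 px]] := x0 i; apply: contrapT => /forallNP h.
  have xgt0 j : 0 < dot z (x i j) by rewrite ltNge; apply/negP.
  have : \sum_j p j * dot z (x i j) == 0.
    by under eq_bigr do rewrite -dotZr; rewrite -dot_sumr px dot0r.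
  rewrite psumr_eq0 => [/allP p_eq0|j _]; last by rewrite mulr_ge0// ltW.
  move/eqP: p1; rewrite big1 ?(eq_sym 0) ?oner_eq0// => j _; apply/eqP.
  by have := p_eq0 j (mem_index_enum _); rewrite /= mulf_eq0 (gt_eqF (xgt0 j)) orbF.
pose X (c : {ffun 'I_D.+1 -> I}) : 'M[R]_(D.+1, D) := \matrix_i x i (c i).
have XE c (w : 'rV_D.+1) : w *m X c = \sum_i w 0 i *: x i (c i).
  by rewrite mulmx_sum_row; under eq_bigr do rewrite rowK.
have /choice[W WP] c : exists w, simplex w /\ forall w', simplex w' ->
    dot (w *m X c) (w *m X c) <= dot (w' *m X c) (w' *m X c).
  by have [w] := simplex_min (X c); exists w.
have /choice[c0 _] := x_le0 0.
case: (@arg_minP _ _ _ (finfun c0) xpredT (fun c => dot (W c *m X c) (W c *m X c))) => //.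
move=> c _ cmin; exists c, (W c); split; first exact: (WP c).1.
rewrite -XE; apply: contrapT => /eqP z_neq0.
have [w [i [ws wz wi]]] := nearest_face (WP c).1 (WP c).2 z_neq0.
set z := W c *m X c in cmin z_neq0 wz.
have [j xj] := x_le0 z i.
pose c' := [ffun k => if k == i then j else c k].
(* Colour [i] has weight 0 in [w], so exchanging its point does not move [z]. *)
have wc' : w *m X c' = z.
  rewrite -wz !XE; apply: eq_bigr => k _; rewrite ffunE.
  by case: eqVneq => // ->; rewrite wi !scale0r.
have : dot z z <= dot z (x i j).
  apply: nearest_dot => t t01; apply: le_trans (cmin c' isT) _.
  have -> : (1 - t) *: z + t *: x i j = ((1 - t) *: w + t *: delta_mx 0 i) *m X c'.
    by rewrite mulmxDl -!scalemxAl -rowE rowK wc' ffunE eqxx.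
  by apply: (WP c').2; apply: simplex_conv => //; exact: simplex_delta.
move/le_trans => /(_ _ xj); apply/negP; rewrite -ltNge lt_neqAle eq_sym dot_eq0.
by rewrite z_neq0 dot_ge0.
Qed.

(* Sarkaria's tensor trick: the only linear dependencies of the [r.+1] vectors
   [v j] are the constant ones, so a vanishing combination of the
   [(a i, 1) (x) v (c i)] has equal block sums [S j]. *)
Lemma tverberg (R : realType) (d r : nat) (a : 'I_((d + 1) * r).+1 -> 'rV[R]_d) :
  exists (c : 'I_((d + 1) * r).+1 -> 'I_r.+1) (p : 'rV[R]_d),
    forall j, conv_hull (a @` [set i | c i = j]) p.
Proof.
pose b i : 'rV[R]_(d + 1) := row_mx (a i) 1.
(* [v ord0] has all entries -1 and the others form the standard basis, so the sum is 0. *)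
pose v (j : 'I_r.+1) : 'rV[R]_r := \row_k ((j == lift ord0 k)%:R - (j == ord0)%:R).
have sv : \sum_j v j = 0.
  apply/rowP => k; rewrite summxE mxE.
  under eq_bigr do rewrite mxE.
  rewrite sumrB (bigD1 (lift ord0 k))//= eqxx big1 => [|j /negbTE->]//.
  by rewrite (bigD1 ord0)//= big1 => [|j /negbTE->]//; rewrite !addr0 subrr.
have [i|c [w [[w0 w1] cw]]] :=
    @colorful_caratheodory R _ _ (fun i j => mxvec ((b i)^T *m v j)).
  exists (fun=> r.+1%:R^-1); split=> [j||]; first by rewrite invr_ge0.
    by rewrite sumr_const card_ord -[_ *+ _]mulr_natl divff// pnatr_eq0.
  by rewrite -scaler_sumr -linear_sum -mulmx_sumr sv mulmx0 linear0 scaler0.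
pose S j := \sum_(i | c i == j) w 0 i *: b i.
have SE j : S j = S ord0.
  case: (unliftP ord0 j) => [k ->|-> //].
  apply/rowP => l; apply/eqP; rewrite -subr_eq0; apply/eqP.
  (* Entry [l], [k] of the vanishing combination is the difference of the [l]-th entries of
     [S (lift ord0 k)] and [S ord0]. *)
  have := congr1 (fun u => vec_mx u l k) cw.
  rewrite linear_sum linear0 summxE mxE => <-.
  rewrite /S !summxE big_mkcond [X in _ - X]big_mkcond -sumrB; apply: eq_bigr => i _.
  have bv : ((b i)^T *m v (c i)) l k =
      b i 0 l * ((c i == lift ord0 k)%:R - (c i == ord0)%:R).
    by rewrite mxE big_ord1 mxE [v _ _ _]mxE.
  have scaleE m n (M : 'M[R]_(m, n)) i1 i2 : (w 0 i *: M) i1 i2 = w 0 i * M i1 i2.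
    by rewrite mxE.
  rewrite linearZ /= mxvecK !scaleE bv.
  by case: eqP; case: eqP => _ _ /=; ring.
pose W j := \sum_(i | c i == j) w 0 i.
pose V j := \sum_(i | c i == j) w 0 i *: a i.
(* The 1 appended to each point makes [S j] record the total weight [W j] beside the weighted sum
   [V j]. *)
have SV j : S j = row_mx (V j) (W j)%:M.
  apply/rowP => l; rewrite /S summxE mxE; under eq_bigr do rewrite !mxE.
  case: (split l) => q.
    by rewrite summxE; apply: eq_bigr => i _; rewrite mxE.
  by rewrite !mxE (ord1 q) eqxx; apply: eq_bigr => i _; rewrite mulr1.
have VE j : V j = V ord0 by have := SE j; rewrite !SV => /eq_row_mx[].
have WE j : W j = W ord0.
  have := SE j; rewrite !SV => /eq_row_mx[_ /(congr1 (fun A : 'M_1 => A 0 0))].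
  by rewrite !mxE.
have W_gt0 : 0 < W ord0.
  have : \sum_j W j = 1.
    by rewrite -w1 (partition_big c xpredT).
  under eq_bigr do rewrite WE.
  rewrite sumr_const card_ord => W1; rewrite -(pmulrn_lgt0 _ (ltn0Sn r)) W1.
  exact: ltr01.
exists c, ((W ord0)^-1 *: V ord0) => j.
rewrite -(WE j) -(VE j); apply: conv_hull_sum; last by rewrite -/(W j) WE.
  by move=> i _; exact: w0.
by move=> i /eqP ci; exists i.
Qed.

(** * Twelve points without a good partition *)

(* Found by a random search among small integer points. *)
Definition points : seq (int * int * int) :=
  [:: (3, - 1, - 1); (4, - 4, 1); (4, - 5, - 2); (- 5, 2, 4);
   (4, 4, - 4); (2, 3, 5); (5, 5, - 5); (- 5, - 3, - 5);
   (- 2, - 1, - 2); (2, 1, 0); (3, 4, - 3); (2, 1, 1)].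

(* [(a, b, c, d)] stands for the plane [a x + b y + c z = d]. The list is
   a greedy cover of the partitions that have to be excluded. *)
Definition planes : seq (int * int * int * int) :=
  [:: (0, 0, 1, - 2); (7, - 3, 1, 11); (5, 3, - 1, 12); (2, - 21, 11, - 6);
   (- 3, - 1, - 1, - 8); (7, - 9, - 3, 4); (6, 1, 7, 0); (- 6, - 1, - 1, - 17);
   (- 2, - 13, 11, - 6); (- 21, - 17, - 29, - 45); (4, - 5, 0, - 5); (2, - 23, 13, - 7);
   (- 3, 10, 16, - 36); (13, 4, - 1, 34); (- 4, 1, - 7, - 7); (12, 5, 1, 29);
   (1, 1, - 2, 2); (- 1, - 3, - 5, 4); (15, - 19, - 3, - 5); (6, - 22, 9, - 9);
   (0, - 5, 3, - 1); (3, 1, 3, 4); (- 21, - 11, - 27, - 26); (- 5, - 2, - 4, - 12);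
   (- 10, - 1, - 5, - 25); (13, - 3, 1, 23); (30, 11, - 4, 72); (4, - 5, - 1, 2);
   (0, - 5, 3, 0); (- 3, 0, 1, - 11); (- 20, - 12, - 19, - 52); (14, - 11, 13, - 41);
   (10, 1, 7, 21); (8, 3, - 1, 18); (2, 2, - 3, - 1); (3, 0, 1, 7);
   (12, - 15, - 4, 4); (19, 5, 23, 4); (1, 0, - 2, 2); (5, 8, - 2, - 16);
   (- 33, - 5, - 12, - 83); (9, 3, 11, 5); (2, 4, - 5, 2); (- 4, - 3, - 5, - 11);
   (24, - 33, - 10, 4); (8, - 5, - 12, 40); (1, - 2, 0, - 5); (- 8, - 9, - 12, - 25);
   (1, 0, - 1, 1); (- 1, 0, 1, - 6); (2, - 14, 7, - 4); (3, - 3, 1, - 6);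
   (- 1, 1, 0, - 9); (5, - 5, - 1, 4); (2, - 2, - 1, 1); (1, - 1, - 1, 1);
   (13, 5, - 1, 30); (6, 1, 3, 13); (2, - 4, 1, - 3); (2, - 3, 0, - 6);
   (1, 1, - 1, 0); (2, 5, - 2, - 14)].

(** * Exhaustive check of the block partitions *)

Definition above (h : int * int * int * int) (p : int * int * int) : bool :=
  let: (a, b, c, d) := h in let: (x, y, z) := p in d < a * x + b * y + c * z.

Definition sides : seq (seq bool) :=
  [seq [seq above h p | p <- points] | h <- planes].

(** An open half-space and its closed complement are disjoint, so points on the plane do no harm. *)
Definition half_spaces : seq (seq bool) :=
  sides ++ [seq map negb h | h <- sides].

(* A set of points is encoded by the list of its indices in [points], a half-space
   by the list of its truth values on [points]. *)
Definition separators (X : seq nat) : seq (seq bool) :=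
  [seq h <- half_spaces | all (fun p => ~~ nth false h p) X].

Definition separated (S : seq (seq bool)) (X : seq nat) : bool :=
  has (fun h => all (nth false h) X) S.

Fixpoint ksplits (T : Type) (k : nat) (s : seq T) : seq (seq T * seq T) :=
  match s with
  | [::] => if k is 0%N then [:: ([::], [::])] else [::]
  | x :: s' =>
    (if k is k'.+1 then [seq (x :: p.1, p.2) | p <- ksplits k' s'] else [::])
    ++ [seq (p.1, x :: p.2) | p <- ksplits k s']
  end.

Lemma ksplits_filter (T : eqType) (a : pred T) (s : seq T) :
  ([seq x <- s | a x], [seq x <- s | ~~ a x]) \in ksplits (count a s) s.
Proof.
elim: s => [|x s IHs]; first by rewrite inE.
rewrite /= mem_cat; case: (a x) => /=.
  by apply/orP; left; apply/mapP; exists ([seq x <- s | a x], [seq x <- s | ~~ a x]).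
by apply/orP; right; apply/mapP; exists ([seq x <- s | a x], [seq x <- s | ~~ a x]).
Qed.

(* However disjoint blocks of the prescribed sizes [ks] are chosen in [s], some
   half-space separates two of them, or separates one of them from an already
   chosen block, whose separating half-spaces are listed in [D]. The [if] is
   there because [||] does not short-circuit under [vm_compute]. *)
Fixpoint blocked (ks : seq nat) (D : seq (seq (seq bool))) (s : seq nat) :=
  if ks is k :: ks' then
    all (fun p => if has (separated^~ p.1) D then true
                  else blocked ks' (separators p.1 :: D) p.2) (ksplits k s)
  else false.

Definition block (J : eqType) (c : nat -> J) (j : J) : seq nat :=
  [seq p <- iota 0 12 | c p == j].

(** Among all splits tried is the one that takes out the block of [j]; what remains of [s] still
    contains the later blocks in full. *)
Lemma blockedP (J : eqType) (c : nat -> J) (js : seq J) D s :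
    uniq js -> {in js, forall j, [seq p <- s | c p == j] = block c j} ->
    blocked [seq size (block c j) | j <- js] D s ->
  (exists S j, [/\ S \in D, j \in js & separated S (block c j)]) \/
  (exists i j, i != j /\ separated (separators (block c i)) (block c j)).
Proof.
elim: js D s => [//|j js IHjs] D s /= /andP[jjs ujs] sP.
have jP : [seq p <- s | c p == j] = block c j by apply: sP; rewrite mem_head.
rewrite -jP size_filter => /allP/(_ _ (ksplits_filter _ _))/=.
case: ifP => [/hasP[S SD Sj] _|_].
  by left; exists S, j; split; rewrite ?mem_head -?jP.
move/IHjs => -/(_ ujs) [i ijs|[S [i [+ ijs Si]]]|[i [i' ii']]];
  last by right; exists i, i'.
- rewrite -filter_predI -sP ?inE ?ijs ?orbT//; apply: eq_filter => p /=.
  by case: eqVneq => //= ->; apply: contraNneq jjs => <-.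
- rewrite inE => /predU1P[SE|SD]; last by left; exists S, i; rewrite inE ijs orbT.
  right; exists j, i; split; first by apply: contraNneq jjs => ->.
  by rewrite -jP -SE.
Qed.

Definition blocked_sizes : seq (seq nat) :=
  [:: [:: 1; 1]; [:: 1; 2]; [:: 1; 3]; [:: 2; 2];
      [:: 2; 3; 3; 4]; [:: 3; 3; 3; 3]]%N.

Lemma blocked_sizesP ks : ks \in blocked_sizes -> blocked ks [::] (iota 0 12).
Proof.
have checked : all (fun ks => blocked ks [::] (iota 0 12)) blocked_sizes.
  by vm_compute.
by move/(allP checked).
Qed.

(** Sort the sizes. If the two smallest add up to at least 5, the second is at least 3, and the sum
    12 leaves only two quadruples. *)
Lemma blocked_sizes4 (n : 'I_4 -> nat) :
    (forall j, 0 < n j)%N -> (\sum_j n j = 12)%N ->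
  exists2 js, uniq js & [seq n j | j <- js] \in blocked_sizes.
Proof.
move=> n_gt0 n12.
pose js := sort (relpre n leq) (enum 'I_4).
have ujs : uniq js by rewrite sort_uniq enum_uniq.
have sjs : size js = 4%N by rewrite size_sort size_enum_ord.
have : sorted leq [seq n j | j <- js].
  rewrite sorted_map; apply: sort_sorted => i j; exact: leq_total.
have : sumn [seq n j | j <- js] = 12%N.
  by rewrite sumnE big_map (perm_big (enum 'I_4)) ?perm_sort// big_enum.
have : all (leq 1) [seq n j | j <- js] by apply/allP => _ /mapP[j _ ->].
case: js ujs sjs => [|a [|b [|c [|d []]]]]//= ujs _.
move=> /and5P[a0 b0 c0 d0 _] sum /and4P[ab bc cd _].
have [ab4|ab5] := leqP (n a + n b) 4.
  exists [:: a; b]; first by move: ujs; rewrite /= !inE !negb_or => /andP[/and3P[->]].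
  have : ((n a, n b) \in [:: (1, 1); (1, 2); (1, 3); (2, 2)])%N.
    rewrite !inE !xpair_eqE; lia.
  by rewrite /= !inE => /or4P[]/eqP[-> ->].
exists [:: a; b; c; d] => //=.
have : ((n a, n b, n c, n d) \in [:: (2, 3, 3, 4); (3, 3, 3, 3)])%N.
  rewrite !inE !xpair_eqE; lia.
by rewrite /= !inE => /orP[]/eqP[-> -> -> ->].
Qed.

(** * From the check to disjoint hulls *)

Definition point (R : realType) (p : nat) : 'rV[R]_3 :=
  let: (x, y, z) := nth (0, 0, 0) points p in
  \row_k (nth 0 [:: x; y; z] k)%:~R.

Definition height (R : realType) (h : int * int * int * int) (v : 'rV[R]_3) : R :=
  let: (a, b, c, d) := h in
  \sum_(k < 3) (nth 0 [:: a; b; c] k)%:~R * v 0 k - d%:~R.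

Lemma height_point (R : realType) h p :
  0 < height h (point R p) = above h (nth (0, 0, 0) points p).
Proof.
case: h => [[[a b] c] d]; rewrite /height /point /above.
case: (nth _ _ _) => [[x y] z].
rewrite !big_ord_recl big_ord0 !mxE /= addr0.
by rewrite -!intrM -!intrD -intrB ltr0z subr_gt0 addrA.
Qed.

Lemma height_conv (R : realType) h (t : {i01 R}) (u v : convex_lmodType 'rV[R]_3) :
  height h (u <| t |> v) = t%:num * height h u + (1 - t%:num) * height h v.
Proof.
case: h => [[[a b] c] d]; rewrite /height !mulrBr !mulr_sumr.
rewrite addrACA -opprD -mulrDl subrKC mul1r; congr (_ - _).
rewrite -big_split; apply: eq_bigr => k _ /=.
rewrite !mxE /unstable.onem /=; ring.
Qed.

(** The boolean [b] treats the open half-space and its closed complement together; both are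
    convex. *)
Lemma half_space_conv_hull (R : realType) h (A : set 'rV[R]_3) (b : bool) :
  (forall v, A v -> (0 < height h v) = b) ->
  forall v, conv_hull A v -> (0 < height h v) = b.
Proof.
move=> Ab; pose C : set (convex_lmodType 'rV[R]_3) :=
  [set v | (0 < height h (v : 'rV_3)) = b].
apply: (@conv_hull_min _ _ A C) => // u v t; rewrite !inE /C /= height_conv.
move: (height h u) (height h v) => x y.
have t0 : 0 <= t%:num :> R by [].
have t1 : t%:num <= 1 :> R by [].
move: t%:num t0 t1 => {}t t0 t1.
case: b {C Ab} => [x0 y0|/negbT + /negbT +].
  by nra.
rewrite -!leNgt => x0 y0; apply/negbTE; rewrite -leNgt; nra.
Qed.

Lemma separated_disjoint (R : realType) (X Y : seq nat) :
    all (gtn 12) X -> all (gtn 12) Y -> separated (separators X) Y ->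
  conv_hull [set point R p | p in [set` X]] `&`
  conv_hull [set point R p | p in [set` Y]] = set0.
Proof.
rewrite /separated /separators => /allP X12 /allP Y12 /hasP[s].
rewrite mem_filter => /andP[/allP Xs hs] /allP Ys.
(* [b] tells whether [s] is the complement of the open side of [h]; beyond 12, [nth] returns its
   default. *)
have [h [b bs]] : exists h b, forall p, (p < 12)%N ->
    nth false s p = b (+) (0 < height h (point R p)).
  move: hs; rewrite mem_cat => /orP[/mapP[h _ ->]|/mapP[_ /mapP[h _ ->] ->]].
    exists h, false => p p12.
    by rewrite (nth_map (0, 0, 0))// height_point.
  exists h, true => p p12.
  by rewrite (nth_map false) ?size_map// (nth_map (0, 0, 0))// height_point.
rewrite -subset0 => v [vX vY].
have : (0 < height h v) = b.
  apply: half_space_conv_hull vX => _ [p pX <-].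
  have := Xs p pX; rewrite (bs _ (X12 _ pX)).
  by case: (b) => /=; [rewrite negbK => ->|move/negbTE].
rewrite (_ : 0 < _ = ~~ b); first by case: (b).
apply: half_space_conv_hull vY => _ [p pY <-].
by have := Ys p pY; rewrite (bs _ (Y12 _ pY)); case: (b) => /= [/negbTE|].
Qed.

(* Only the first [n] of the twelve points are given; the indices of the others
   go to class [ord0], which can only enlarge the hulls. *)
Lemma tverberg_sizes_gt12 (R : realType) (n : nat) :
  tverberg_sizes R 3 4 2 n -> (12 < n)%N.
Proof.
move=> [n_gt0 /(_ (fun i => point R i))[N [Ntriv Ncov Nmeet]]].
rewrite ltnNge; apply/negP => n12.
have Nex (i : 'I_n) : exists j, N j i.
  have [j _ Nji] : (\bigcup_j N j) i by rewrite Ncov.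
  by exists j.
pose c p : 'I_4 := if insub p is Some i then xget ord0 [set j | N j i] else ord0.
have cP (i : 'I_n) j : N j i -> c i = j.
  move=> Nji; rewrite /c valK; case: xgetP => [k _ Nki|/(_ j)//].
  by apply: (Ntriv k j I I); exists i.
have blk12 j : all (gtn 12) (block c j).
  by apply/allP => p; rewrite mem_filter mem_iota => /andP[].
have Nblk j : [set point R i | i in N j] `<=` [set point R p | p in [set` block c j]].
  move=> _ [i Nji <-]; exists (val i) => //=.
  by rewrite mem_filter (cP _ _ Nji) eqxx mem_iota/= add0n (leq_trans (ltn_ord i)).
have meet i j : i != j -> exists v,
    conv_hull [set point R p | p in [set` block c i]] v /\
    conv_hull [set point R p | p in [set` block c j]] v.
  move=> ij; have ij2 : #|[set i; j]%SET| = 2%N by rewrite cards2 ij.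
  have [v vP] := Nmeet _ ij2.
  exists v; split; apply: (sub_conv_hull (@Nblk _)); apply: vP => /=.
    by rewrite !inE eqxx.
  by rewrite !inE eqxx orbT.
have blk_gt0 j : (0 < size (block c j))%N.
  have [i ij] : exists i : 'I_4, i != j.
    by have [->|j0] := eqVneq j ord0; [exists ord_max|exists ord0; rewrite eq_sym].
  have [v [_ vj]] := meet i j ij; rewrite lt0n size_eq0; apply: contraPneq vj => ->.
  by rewrite set_nil image_set0 conv_hull0.
have blk_sum : (\sum_j size (block c j) = 12)%N.
  rewrite -[RHS](size_iota 0 12) -sum1_size (partition_big c xpredT)//=.
  by apply: eq_bigr => j _; rewrite size_filter sum1_count.
have [js ujs /blocked_sizesP] := blocked_sizes4 blk_gt0 blk_sum.
case/(blockedP ujs (fun _ _ => erefl)) => [[S [j []]]//|[i [j [ij]]]].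
move=> /(separated_disjoint R (blk12 i) (blk12 j)).
by have [v [vi vj]] := meet i j ij; rewrite -subset0 => /(_ v); apply.
Qed.

Lemma tverberg_sizes_tverberg (R : realType) (d r k : nat) :
  tverberg_sizes R d r.+1 k ((d + 1) * r).+1.
Proof.
split=> // a; have [c [p pP]] := tverberg a.
exists (fun j => [set i | c i = j]); split.
- by move=> i j _ _ [l [/= <- <-]].
- by apply/seteqP; split => // i _; exists (c i).
- by move=> J _; exists p => j _; exact: pP.
Qed.

Theorem theorem3 (R : realType) : T R 3 4 2 = 13%N.
Proof.
(* Here [r.+1] is 4 and [((3 + 1) * 3).+1] computes to 13. *)
have T13 : tverberg_sizes R 3 4 2 13 := tverberg_sizes_tverberg R 3 3 2.
(* The default case of [xget] is impossible, since 13 is a least element. *)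
rewrite /T; case: xgetP => [n _ [Tn n_lb]|/(_ 13%N)].
  by apply/eqP; rewrite eqn_leq (tverberg_sizes_gt12 Tn) andbT; exact: n_lb.
by case; split=> // n; exact: tverberg_sizes_gt12.
Qed.
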